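(* Let $T$ be an expandable tree and let $\mathcal{T}\subseteq\mathcal{A}^T$ be a tree-shift on $T$, where $\mathcal{A}$ is a finite alphabet with $|\mathcal{A}|\ge2$. Then $h(\mathcal{T})>0$ if and only if $h^{(S)}(\mathcal{T})>0$.
   Context: Trees. A tree $T$ is a countable, locally finite (connected) graph without loops (cycles), with a root $\epsilon$, whose vertices are represented as words over $d$ generators $g_1,\dots,g_d$: $T$ is a set of finite words over $\{g_1,\dots,g_d\}$ containing the empty word $\epsilon$ and closed under taking prefixes, with an edge from $g$ to $gg_i$ whenever both are in $T$. $T_n$ is the set of vertices of $T$ of length $n$ (at distance $n$ from $\epsilon$), and $\Delta_n=\bigcup_{i=0}^nT_i$. The expanding number of $T$ is $\gamma_T=\lim_{n\to\infty}|T_{n+1}|/|T_n|$, whenever this limit exists. $T$ is expandable if $\gamma_T$ exists and $\gamma_T>1$. Tree-shifts. A labeled tree is a function $t:T\to\mathcal{A}$, written $t=(t_g)_{g\in T}$. A tree-shift $\mathcal{T}\subseteq\mathcal{A}^T$ is the set of all labeled trees that avoid every member of some given set of forbidden blocks, where a block is a labeling $p:F\to\mathcal{A}$ of a finite nonempty set $F$ of words over the generators, and $t$ avoids $p$ if there is no $g\in T$ with $gF\subseteq T$ and $t_{gh}=p_h$ for all $h\in F$. The entropy is $$h(\mathcal{T})=\limsup_{n\to\infty}\frac{\log|\mathcal{P}(\Delta_n,\mathcal{T})|}{|\Delta_n|},\qquad \mathcal{P}(\Delta_n,\mathcal{T})=\{(x_g)_{g\in\Delta_n}:x\in\mathcal{T}\},$$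 and the (topological) surface entropy is $$h^{(S)}(\mathcal{T})=\limsup_{n\to\infty}\frac{\log|B_n^{(S)}(\mathcal{T})|}{|T_n|},\qquad B_n^{(S)}(\mathcal{T})=\{t|_{T_n}:t\in\mathcal{T}\}.$$ *)

(* Defs.v *)
From HB Require Import structures.
From mathcomp Require Import all_boot all_order all_algebra finmap.
From mathcomp Require Import all_classical all_reals all_analysis.

Set Implicit Arguments.
Unset Strict Implicit.
Unset Printing Implicit Defensive.
Import Order.TTheory GRing.Theory Num.Theory.
Import numFieldNormedType.Exports.
Local Open Scope classical_set_scope.
Local Open Scope ring_scope.

(* The generators g_1, ..., g_d are the elements of 'I_d; words are sequences,
   the root is [::] and the product of words is concatenation. *)
Record tree (d : nat) := Tree {
  vertices :> {pred seq 'I_d};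
  root_in_tree : [::] \in vertices;
  tree_prefix_closed : forall u v : seq 'I_d,
    prefix u v -> v \in vertices -> u \in vertices
}.

Definition vertex (d : nat) (T : tree d) := {g : seq 'I_d | g \in T}.

Definition labeled_tree (d : nat) (T : tree d) (A : Type) := vertex T -> A.

Section Windows.
Variables (d : nat) (T : tree d) (n : nat).

(* T_n; n.-tuple 'I_d is the type of words of length n. *)
Definition level := {w : n.-tuple 'I_d | tval w \in T}.

(* Delta_n; n.-bseq 'I_d is the type of words of length at most n. *)
Definition initial_subtree := {w : n.-bseq 'I_d | bseqval w \in T}.

Definition level_vertex (w : level) : vertex T :=
  exist _ (tval (val w)) (valP w).

Definition initial_vertex (w : initial_subtree) : vertex T :=
  exist _ (bseqval (val w)) (valP w).

End Windows.

(* If some level is empty, so are all later ones and the ratio is eventually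
   0 / 0 = 0, so that such a (finite) tree is not expandable below. *)
Definition level_ratio (R : realType) (d : nat) (T : tree d) (n : nat) : R :=
  #|{: level T n.+1}|%:R / #|{: level T n}|%:R.

Definition expanding_number (R : realType) (d : nat) (T : tree d) : R :=
  limn (level_ratio R T).

Definition expandable (R : realType) (d : nat) (T : tree d) : Prop :=
  cvgn (level_ratio R T) /\ 1 < expanding_number R T.

Section TreeShifts.
Variables (d : nat) (T : tree d) (A : finType).

(* A block p : F -> A is a finite map with domain F = domf p. *)
Definition occurs_at (p : {fmap seq 'I_d -> A}) (t : labeled_tree T A)
    (g : seq 'I_d) : Prop :=
  forall h : domf p,
    exists ghT : g ++ fsval h \in T, t (exist _ (g ++ fsval h) ghT) = p h.

Definition avoids (t : labeled_tree T A) (p : {fmap seq 'I_d -> A}) : Prop :=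
  ~ exists2 g, g \in T & occurs_at p t g.

Definition is_tree_shift (X : set (labeled_tree T A)) : Prop :=
  exists forbidden : set {fmap seq 'I_d -> A},
    (forall p, forbidden p -> domf p != fset0) /\
    X = [set t | forall p, forbidden p -> avoids t p].

(* The patterns (t_g)_(g in D), t in X, on a finite window D of T. *)
Definition patterns (D : finType) (e : D -> vertex T)
    (X : set (labeled_tree T A)) : {pred {ffun D -> A}} :=
  [pred p | `[< exists2 t, X t & p = [ffun w => t (e w)] >]].

Definition initial_patterns (n : nat) (X : set (labeled_tree T A)) :=
  patterns (@initial_vertex d T n) X.

Definition level_patterns (n : nat) (X : set (labeled_tree T A)) :=
  patterns (@level_vertex d T n) X.

Arguments initial_patterns n X : clear implicits.
Arguments level_patterns n X : clear implicits.

(* lne is the logarithm with lne 0 = -oo, so the empty tree-shift has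
   entropy -oo. *)
Definition entropy (R : realType) (X : set (labeled_tree T A)) : \bar R :=
  limn_esup (fun n =>
    lne (#|initial_patterns n X|%:R)%:E / (#|{: initial_subtree T n}|%:R)%:E)%E.

Definition surface_entropy (R : realType) (X : set (labeled_tree T A)) :
    \bar R :=
  limn_esup (fun n =>
    lne (#|level_patterns n X|%:R)%:E / (#|{: level T n}|%:R)%:E)%E.

End TreeShifts.

(* Main.v *)
Require Import Defs.
From mathcomp Require Import all_boot all_order all_algebra finmap.
From mathcomp Require Import all_classical all_reals all_analysis.
From mathcomp Require Import ring lra.

Set Implicit Arguments.
Unset Strict Implicit.
Unset Printing Implicit Defensive.
Import Order.TTheory GRing.Theory Num.Theory.
Import numFieldNormedType.Exports.
Local Open Scope classical_set_scope.
Local Open Scope ring_scope.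

(** The theorem is an instance of a comparison between two growth rates.  Let
    s_n = |T_n|, D_n = |Delta_n|, and let a_n and b_n be the numbers of patterns
    of the tree-shift on Delta_n and on T_n.  Since Delta_(n+1) is the disjoint
    union of Delta_n and T_(n+1), and since T_n is contained in Delta_n,
      D_(n+1) = D_n + s_(n+1),  a_(n+1) <= a_n b_(n+1),  b_n <= a_n
    ([card_initial_subtreeS], [leq_card_patternsM], [leq_card_patterns]).

    Expandability says that s_n eventually grows by a factor at least r > 1.
    A geometrically growing sequence is comparable to its partial sums, so
    D_n <= K s_n for some constant K ([cumulative_geometric_bound]); hence
    ln b_n > e s_n forces ln a_n >= ln b_n > (e / K) D_n, and positive surface
    entropy implies positive entropy ([cumulative_rate_gt0]).

    Conversely, if ln b_n <= (e / 2) s_n for all n >= N, then summing the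
    logarithms over the levels gives ln a_n <= ln a_N + (e / 2) D_n.  As D_n
    tends to infinity, ln a_n > e D_n is then impossible for large n.  So
    positive entropy implies positive surface entropy ([level_rate_gt0]).

    Both arguments only use that a limit superior is positive if and only if
    some e > 0 is exceeded infinitely often ([limn_esup_rate_gt0P]). *)

(** * Patterns on overlapping windows *)

Section PatternCounts.
Variables (d : nat) (T : tree d) (A : finType) (X : set (labeled_tree T A)).

Lemma patterns_restrict (D D' : finType) (e : D -> vertex T)
    (e' : D' -> vertex T) (f : D' -> D) (p : {ffun D -> A}) :
  e' =1 e \o f -> p \in patterns e X ->
  [ffun w => p (f w)] \in patterns e' X.
Proof.
move=> e'E /asboolP[t Xt ->]; apply/asboolP.
by exists t => //; apply/ffunP => w; rewrite !ffunE e'E.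
Qed.

(** Every pattern on the smaller window is a restriction of one on the larger
    window: both come from the same labeled tree. *)
Lemma leq_card_patterns (D D' : finType) (e : D -> vertex T)
    (e' : D' -> vertex T) (f : D' -> D) :
  e' =1 e \o f -> (#|patterns e' X| <= #|patterns e X|)%N.
Proof.
move=> e'E.
pose restr (p : {ffun D -> A}) : {ffun D' -> A} := [ffun w => p (f w)].
apply: leq_trans (leq_image_card restr (patterns e X)).
apply/subset_leq_card/fintype.subsetP => q.
move=> /asboolP[t Xt ->]; apply/fintype.imageP.
exists [ffun w => t (e w)]; first by apply/asboolP; exists t.
by apply/ffunP => w; rewrite !ffunE e'E.
Qed.

(** A pattern on a window covered by two smaller ones is determined by its two
    restrictions, but two patterns need not be compatible, whence only an
    inequality. *)
Lemma leq_card_patternsM (D D1 D2 : finType) (e : D -> vertex T)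
    (e1 : D1 -> vertex T) (e2 : D2 -> vertex T) (f1 : D1 -> D) (f2 : D2 -> D) :
  e1 =1 e \o f1 -> e2 =1 e \o f2 ->
  (forall w, (exists w1, f1 w1 = w) \/ (exists w2, f2 w2 = w)) ->
  (#|patterns e X| <= #|patterns e1 X| * #|patterns e2 X|)%N.
Proof.
move=> e1E e2E cover.
pose restr (p : {ffun D -> A}) : {ffun D1 -> A} * {ffun D2 -> A} :=
  ([ffun w => p (f1 w)], [ffun w => p (f2 w)]).
have restr_inj : injective restr.
  move=> p q [/ffunP eq1 /ffunP eq2]; apply/ffunP => w.
  case: (cover w) => [[w1 <-]|[w2 <-]].
    by have := eq1 w1; rewrite !ffunE.
  by have := eq2 w2; rewrite !ffunE.
rewrite -(fintype.card_image restr_inj) -cardX.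
apply/subset_leq_card/fintype.subsetP => _ /fintype.imageP[p Xp ->]; rewrite inE /=.
by apply/andP; split; apply: patterns_restrict Xp.
Qed.

End PatternCounts.

(** * Decomposition of an initial subtree into levels *)

Section Windows.
Variables (d : nat) (T : tree d) (n : nat).

Definition level_initial (m : nat) (w : level T m) : initial_subtree T m :=
  exist _ (bseq_of_tuple (val w)) (valP w).

Definition initial_widen (w : initial_subtree T n) : initial_subtree T n.+1 :=
  exist _ (widen_bseq (leqnSn n) (val w)) (valP w).

Lemma level_initialE (m : nat) :
  @level_vertex d T m =1 @initial_vertex d T m \o @level_initial m.
Proof. by move=> w; apply: val_inj. Qed.

Lemma initial_widenE :
  @initial_vertex d T n =1 @initial_vertex d T n.+1 \o initial_widen.
Proof. by move=> w; apply: val_inj. Qed.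

Lemma initial_subtreeS_cover (w : initial_subtree T n.+1) :
  (exists w1, initial_widen w1 = w) \/ (exists w2, level_initial w2 = w).
Proof.
case: w => -[w sz] Tw; case: (leqP (size w) n) => szn.
  by left; exists (exist _ (Bseq szn) Tw); do 2!apply: val_inj.
have szw : size w == n.+1 by rewrite eqn_leq sz szn.
by right; exists (exist _ (Tuple szw) Tw); do 2!apply: val_inj.
Qed.

Lemma card_initial_subtreeS :
  #|{: initial_subtree T n.+1}| =
  (#|{: initial_subtree T n}| + #|{: level T n.+1}|)%N.
Proof.
pose f (w : initial_subtree T n + level T n.+1) :=
  match w with inl u => initial_widen u | inr u => level_initial u end.
have f_inj : injective f.
  move=> [[[u su] Tu]|[[u su] Tu]] [[[v sv] Tv]|[[v sv] Tv]] /(congr1 val)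
    /(congr1 val) /= uv; subst v.
  - by congr inl; do 2!apply: val_inj.
  - by exfalso; have := su; rewrite /= (eqP sv) ltnn.
  - by exfalso; have := sv; rewrite /= (eqP su) ltnn.
  - by congr inr; do 2!apply: val_inj.
rewrite -card_sum -(card_codom f_inj); apply/esym/eq_card => w.
rewrite inE; apply/codomP.
by case: (initial_subtreeS_cover w) => -[u <-]; [exists (inl u)|exists (inr u)].
Qed.

End Windows.

(** * Positivity of an exponential growth rate *)

Section ExponentialRates.
Variable R : realType.

Lemma limn_esup_gt0P (u : (\bar R)^nat) :
  (0 < limn_esup u)%E <->
  exists2 e : R, 0 < e &
    forall N, exists2 n, (N <= n)%N & (e%:E < u n)%E.
Proof.
split=> [u0|[e e0 ue]].
  have [e e0 eu] : exists2 e : R, 0 < e & (e%:E < limn_esup u)%E.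
    case: (limn_esup u) u0 => [x| |] //; last by exists 1 => //; rewrite ltry.
    by rewrite lte_fin => x0; exists (x / 2); rewrite ?lte_fin; lra.
  exists e => // N.
  have : (e%:E < ereal_sup (u @` [set n | (N <= n)%N]))%E.
    apply: lt_le_trans eu _; apply: ereal_inf_lbound.
    by exists [set n | (N <= n)%N] => //; exists N.
  by move=> /ereal_sup_gt[_ [n Nn <-] eun]; exists n.
apply: (@lt_le_trans _ _ e%:E); first by rewrite lte_fin.
apply: le_ereal_inf_tmp => _ [V [N _ NV] <-].
have [n Nn eun] := ue N; apply: le_trans (ltW eun) _.
by apply: ereal_sup_ubound; exists n => //; exact: NV.
Qed.

(** For k = 0 both sides are false, although for different reasons: lne 0 is
    -oo, whereas ln 0 = 0. *)
Lemma lt_lne_div (e : R) (k m : nat) : 0 < e -> (0 < m)%N ->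
  (e%:E < lne (k%:R)%:E / (m%:R)%:E)%E = (e * m%:R < ln (k%:R : R)).
Proof.
move=> e0 m0; have mR : 0 < m%:R :> R by rewrite ltr0n.
rewrite inver gt_eqF// lte_pdivlMr//.
case: k => [|k]; last by rewrite lne_EFin ?ltr0n// lte_fin.
rewrite le0_lneNy// ln0//.
by apply/esym/negbTE; rewrite -leNgt mulr_ge0// ltW.
Qed.

(** The case k = 0, which stands for an empty tree-shift, needs no exception
    because ln 0 = 0 and ln is nonnegative at every natural number. *)
Lemma ler_ln_nat (k m : nat) : (k <= m)%N -> ln (k%:R : R) <= ln m%:R.
Proof.
case: k => [_|k km]; last first.
  by rewrite ler_ln ?posrE ?ltr0n ?ler_nat// (leq_trans _ km).
by case: m => [|m]; rewrite ?lexx// ln0// ln_ge0// ler1n.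
Qed.

Lemma limn_esup_rate_gt0P (k m : nat -> nat) (N0 : nat) :
  (forall n, (N0 <= n)%N -> (0 < m n)%N) ->
  (0 < limn_esup (fun n => lne ((k n)%:R : R)%:E / ((m n)%:R)%:E))%E <->
  exists2 e : R, 0 < e & forall N, exists2 n, (N <= n)%N &
    e * (m n)%:R < ln ((k n)%:R : R).
Proof.
move=> m0; rewrite limn_esup_gt0P; split=> -[e e0 ke]; exists e => // N;
  have [n] := ke (maxn N N0); rewrite geq_max => /andP[Nn N0n].
  by rewrite lt_lne_div ?m0// => ken; exists n.
by move=> ken; exists n => //; rewrite lt_lne_div ?m0.
Qed.

End ExponentialRates.

(** * Comparison of growth rates under geometric growth *)

(** Here s, D, a and b stand for the sizes of the levels and of the initial
    subtrees and for the numbers of patterns on the latter and on the former. *)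
Section GeometricGrowth.
Variables (R : realType) (s D a b : nat -> nat) (r : R) (N0 : nat).
Hypothesis r_gt1 : 1 < r.
Hypothesis s_gt0 : forall n, (N0 <= n)%N -> (0 < s n)%N.
Hypothesis s_growth :
  forall n, (N0 <= n)%N -> r * (s n)%:R < ((s n.+1)%:R : R).
Hypothesis D_rec : forall n, D n.+1 = (D n + s n.+1)%N.

(** The bound propagates from n to n.+1 as soon as K <= (K - 1) r, that is
    K >= r / (r - 1): then K s_n <= (K - 1) s_(n+1).  Adding D_N0 to this value
    of K makes it hold at n = N0 as well, where s_N0 >= 1. *)
Lemma cumulative_geometric_bound :
  exists2 K : R, 0 < K &
    forall n, (N0 <= n)%N -> (D n)%:R <= K * (s n)%:R.
Proof.
have r1 : 0 < r - 1 by rewrite subr_gt0.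
pose K := (D N0)%:R + r / (r - 1).
have rr : 0 < r / (r - 1) by rewrite divr_gt0// (lt_trans ltr01).
have D0 : 0 <= (D N0)%:R :> R by [].
have K0 : 0 < K by rewrite /K; lra.
have K_step : K <= (K - 1) * r.
  have -> : (K - 1) * r = K + (D N0)%:R * (r - 1).
    by rewrite /K; field; rewrite gt_eqF.
  by rewrite lerDl mulr_ge0// ltW.
have K1 : 0 <= K - 1.
  by rewrite -(pmulr_lge0 _ (lt_trans ltr01 r_gt1)) (le_trans _ K_step)// ltW.
have base : (D N0)%:R <= K * (s N0)%:R.
  apply: (@le_trans _ _ K); first by rewrite /K; lra.
  by rewrite ler_pMr// ler1n s_gt0.
exists K => //; elim=> [|n IH]; rewrite leq_eqVlt => /orP[/eqP eqN|N0n].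
- by rewrite -eqN.
- by [].
- by rewrite -eqN.
have step : K * (s n)%:R <= (K - 1) * (s n.+1)%:R.
  apply: (le_trans (ler_wpM2r _ K_step)) => //.
  by rewrite -mulrA ler_wpM2l// ltW// s_growth.
have := IH N0n; rewrite D_rec natrD; lra.
Qed.

Lemma cumulative_geq n : (N0 <= n)%N -> (n - N0 <= D n)%N.
Proof.
elim: n => [//|n IH]; rewrite leq_eqVlt => /orP[/eqP <-|N0n].
  by rewrite subnn.
rewrite D_rec subSn// -addn1 leq_add ?IH// s_gt0//.
exact: leqW.
Qed.

Hypothesis b_le_a : forall n, (b n <= a n)%N.
Hypothesis a_rec : forall n, (a n.+1 <= a n * b n.+1)%N.

Lemma ln_a_rec n : ln ((a n.+1)%:R : R) <= ln (a n)%:R + ln (b n.+1)%:R.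
Proof.
have ln_nat_ge0 k : 0 <= ln (k%:R : R).
  by case: k => [|k]; [rewrite ln0|rewrite ln_ge0// ler1n].
have := a_rec n; case: (posnP (a n)) => [->|an].
  by rewrite mul0n leqn0 => /eqP ->; rewrite ln0// add0r ln_nat_ge0.
case: (posnP (b n.+1)) => [->|bn].
  by rewrite muln0 leqn0 => /eqP ->; rewrite ln0// addr_ge0// ln_nat_ge0.
move=> /(ler_ln_nat R) /le_trans; apply.
by rewrite natrM lnM ?posrE ?ltr0n.
Qed.

Lemma cumulative_rate_gt0 :
  (exists2 e : R, 0 < e & forall N, exists2 n, (N <= n)%N &
     e * (s n)%:R < ln ((b n)%:R : R)) ->
  exists2 e : R, 0 < e & forall N, exists2 n, (N <= n)%N &
    e * (D n)%:R < ln ((a n)%:R : R).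
Proof.
move=> [e e0 be]; have [K K0 DK] := cumulative_geometric_bound.
exists (e / K); first exact: divr_gt0.
move=> N; have [n] := be (maxn N N0); rewrite geq_max => /andP[Nn N0n] ben.
exists n => //; apply: le_lt_trans (lt_le_trans ben (ler_ln_nat R (b_le_a n))).
by rewrite -mulrA ler_pM2l// ler_pdivrMl// DK.
Qed.

Lemma level_rate_gt0 :
  (exists2 e : R, 0 < e & forall N, exists2 n, (N <= n)%N &
    e * (D n)%:R < ln ((a n)%:R : R)) ->
  exists2 e : R, 0 < e & forall N, exists2 n, (N <= n)%N &
     e * (s n)%:R < ln ((b n)%:R : R).
Proof.
move=> [e e0 ae]; exists (e / 2); first by rewrite divr_gt0.
move=> N; apply/not_exists2P => b_small.
have b_le n : (N <= n)%N -> ln ((b n)%:R : R) <= e / 2 * (s n)%:R.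
  by move=> Nn; rewrite leNgt; apply/negP => ben; case: (b_small n).
have ln_a_bound n : (N <= n)%N ->
    ln ((a n)%:R : R) <= ln (a N)%:R + e / 2 * (D n)%:R.
  elim: n => [|n IH]; rewrite leq_eqVlt => /orP[/eqP eqN|Nn].
  - by rewrite -eqN lerDl mulr_ge0// divr_ge0// ltW.
  - by [].
  - by rewrite -eqN lerDl mulr_ge0// divr_ge0// ltW.
  have := IH Nn; have := b_le n.+1 (leqW Nn); have := ln_a_rec n.
  rewrite D_rec natrD mulrDr; lra.
(* Once D n exceeds c, the constant ln (a N) is at most e / 2 * D n. *)
pose c := 2 * ln (a N)%:R / e.
have [n] := ae (maxn N (N0 + (Num.truncn c).+1)).
rewrite geq_max => /andP[Nn cn].
have : c < (D n)%:R.
  apply: lt_le_trans (truncnS_gt c) _; rewrite ler_nat.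
  apply: leq_trans (cumulative_geq (leq_trans (leq_addr _ _) cn)).
  by rewrite leq_subRL// (leq_trans (leq_addr _ _) cn).
rewrite /c ltr_pdivrMr//.
have := ln_a_bound n Nn; lra.
Qed.

End GeometricGrowth.

Theorem corollary1p8 (R : realType) (d : nat) (T : tree d) (A : finType)
    (X : set (labeled_tree T A)) :
  (2 <= #|A|)%N -> expandable R T -> is_tree_shift X ->
  (0 < entropy R X)%E <-> (0 < surface_entropy R X)%E.
Proof.
move=> _ [ratio_cvg gamma_gt1] _.
pose r : R := (1 + expanding_number R T) / 2.
have r_gt1 : 1 < r by rewrite /r; lra.
have : r < expanding_number R T by rewrite /r; lra.
move=> /(cvgr_gt _ ratio_cvg)[N0 _ ratio_gt].
(* If the level n were empty, the ratio would be x / 0 = 0 < r. *)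
have s_gt0 n : (N0 <= n)%N -> (0 < #|{: level T n}|)%N.
  move=> /ratio_gt /=; rewrite /level_ratio lt0n.
  by apply: contraTN => /eqP ->; rewrite invr0 mulr0 -leNgt; lra.
have s_growth n : (N0 <= n)%N ->
    r * #|{: level T n}|%:R < #|{: level T n.+1}|%:R.
  by move=> N0n; rewrite -ltr_pdivlMr ?ltr0n ?s_gt0//; exact: ratio_gt.
have D_gt0 n : (0 < #|{: initial_subtree T n}|)%N.
  by apply/card_gt0P; exists (exist _ [bseq] (root_in_tree T)).
rewrite /entropy /surface_entropy.
rewrite (limn_esup_rate_gt0P _ _ (N0 := 0))// (limn_esup_rate_gt0P _ _ s_gt0).
have a_rec n := leq_card_patternsM X (@initial_widenE _ T n)
  (@level_initialE _ T n.+1) (@initial_subtreeS_cover _ T n).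
have b_le_a n := leq_card_patterns X (@level_initialE _ T n).
split.
  exact: (level_rate_gt0 s_gt0 (card_initial_subtreeS T) a_rec).
exact: (cumulative_rate_gt0 r_gt1 s_gt0 s_growth (card_initial_subtreeS T)
  b_le_a).
Qed.
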